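(* Let $M\subset\mathbb{R}^m$ be a semialgebraic set, let $p\in M$ and let $\{U_k\}_k$ be a countable basis of neighborhoods of $p$ in $M$. Then $\{\operatorname{Cl}_{\beta_s^*M}(U_k)\}_k$ is a countable basis of neighborhoods of $p$ in $\beta_s^*M$.
   Context: $\mathcal{S}^*(M)$ is the ring of bounded continuous semialgebraic functions $M\to\mathbb{R}$ (functions with semialgebraic graph). $\beta_s^*M$ is the set of maximal ideals of $\mathcal{S}^*(M)$ with the topology induced by the Zariski topology (basis of open sets $\{\mathfrak{m}^*: f\notin\mathfrak{m}^*\}$, $f\in\mathcal{S}^*(M)$). The space $M$ (Euclidean topology) is identified with a dense subspace of $\beta_s^*M$ through $p\mapsto\{f\in\mathcal{S}^*(M): f(p)=0\}$. *)

(* Defs.v *)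
From HB Require Import structures.
From mathcomp Require Import all_boot all_order all_algebra.
(* The notations of mpoly clash with those of all_analysis; mpoly n R is
   the ring {mpoly R[n]} of polynomials in n variables over R. *)
From mathcomp Require Import -(notations) mpoly.
From mathcomp Require ordered_qelim qe_rcf.
From mathcomp Require Import all_classical all_reals all_analysis.

Set Implicit Arguments.
Unset Strict Implicit.
Unset Printing Implicit Defensive.

Import Order.TTheory GRing.Theory Num.Theory.
Import numFieldNormedType.Exports.

Local Open Scope classical_set_scope.
Local Open Scope ring_scope.

Section Semialgebraic.
Variable R : rcfType.

Definition peval n (p : mpoly n R) (x : 'rV[R]_n) : R :=
  meval (fun i => x ord0 i) p.

(* The Boolean combinations of polynomial equalities and strict inequalities. *)
Inductive semialgebraic (n : nat) : set 'rV[R]_n -> Prop :=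
| semialgebraic_eq0 (p : mpoly n R) :
    semialgebraic [set x | peval p x = 0]
| semialgebraic_gt0 (p : mpoly n R) :
    semialgebraic [set x | 0 < peval p x]
| semialgebraicC A : semialgebraic A -> semialgebraic (~` A)
| semialgebraicI A B :
    semialgebraic A -> semialgebraic B -> semialgebraic (A `&` B)
| semialgebraicU A B :
    semialgebraic A -> semialgebraic B -> semialgebraic (A `|` B).

Lemma semialgebraicT n : semialgebraic [set: 'rV[R]_n].
Proof.
rewrite (_ : setT = [set x | peval 0 x = 0]); first exact: semialgebraic_eq0.
by apply/seteqP; split=> x //= _; rewrite /peval meval0.
Qed.

Lemma semialgebraic0 n : semialgebraic (@set0 'rV[R]_n).
Proof. by rewrite -setCT; apply/semialgebraicC/semialgebraicT. Qed.

Lemma semialgebraic_preimage n k (q : 'I_k -> mpoly n R) A :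
  semialgebraic A ->
  semialgebraic [set x : 'rV[R]_n | A (\row_(i < k) peval (q i) x)].
Proof.
have E p (x : 'rV[R]_n) : peval p (\row_(i < k) peval (q i) x) =
    peval (comp_mpoly [tuple q i | i < k] p) x.
  rewrite /peval comp_mpoly_meval; apply: meval_eq => i.
  by rewrite mxE tnth_mktuple.
elim=> {A} [p|p|A _ IH|A B _ IHA _ IHB|A B _ IHA _ IHB].
- under eq_set do rewrite /= E; exact: semialgebraic_eq0.
- under eq_set do rewrite /= E; exact: semialgebraic_gt0.
- exact: semialgebraicC.
- exact: semialgebraicI.
- exact: semialgebraicU.
Qed.

(* Tarski-Seidenberg, by quantifier elimination for ordered fields. *)
Import ordered_qelim.ord.

Let env n (x : 'rV[R]_n) : seq R := [seq x ord0 i | i <- enum 'I_n].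

Let nth_env n (x : 'rV[R]_n) (i : 'I_n) : nth 0 (env x) i = x ord0 i.
Proof. by rewrite (nth_map i) ?size_enum_ord // nth_ord_enum. Qed.

Let nth_env0 n (x : 'rV[R]_n) i : (n <= i)%N -> nth 0 (env x) i = 0.
Proof. by move=> ni; rewrite nth_default // size_map size_enum_ord. Qed.

Let term_of_poly n (p : mpoly n R) :
  exists t : GRing.term R, forall x, GRing.eval (env x) t = peval p x.
Proof.
elim/mpolyind: p => [|c m p _ _ [t tE]].
  by exists (GRing.NatConst _ 0) => x; rewrite /peval meval0.
have [u uE] : exists u : GRing.term R, forall x : 'rV[R]_n,
    GRing.eval (env x) u = \prod_(i < n) x ord0 i ^+ m i.
  exists (\big[GRing.Mul/GRing.NatConst _ 1]_(i < n)
    GRing.Exp (GRing.Var _ i) (m i)) => x.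
  rewrite (big_morph (GRing.eval (env x)) (fun _ _ => erefl) erefl).
  by apply: eq_bigr => i _ /=; rewrite nth_env.
exists (GRing.Add (GRing.Mul (GRing.Const c) u) t) => x /=.
by rewrite uE tE /peval mevalD mevalZ mevalX.
Qed.

Let poly_of_term n (t : GRing.term R) : GRing.rterm t ->
  exists p : mpoly n R, forall x, GRing.eval (env x) t = peval p x.
Proof.
rewrite /peval; elim: t => //=.
- move=> i _; have [ni|ni] := ltnP i n.
    exists (mpolyX _ (mnm1 (Ordinal ni))) => x.
    by rewrite mevalXU -nth_env.
  by exists 0 => x; rewrite meval0 nth_env0.
- by move=> c _; exists (mpolyC _ c) => x; rewrite mevalC.
- by move=> k _; exists (mpolyC _ k%:R) => x; rewrite mevalC.
- move=> t IHt u IHu /andP[/IHt[p pE] /IHu[q qE]].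
  by exists (p + q) => x; rewrite pE qE mevalD.
- by move=> t IHt /IHt[p pE]; exists (- p) => x; rewrite pE mevalN.
- by move=> t IHt k /IHt[p pE]; exists (p *+ k) => x; rewrite pE mevalMn.
- move=> t IHt u IHu /andP[/IHt[p pE] /IHu[q qE]].
  by exists (p * q) => x; rewrite pE qE mevalM.
- by move=> t IHt k /IHt[p pE]; exists (p ^+ k) => x; rewrite pE rmorphXn.
Qed.

Let formula_of_semialgebraic n (A : set 'rV[R]_n) : semialgebraic A ->
  exists f : formula R, forall x, holds (env x) f <-> A x.
Proof.
elim=> {A} [p|p|A _ [f fE]|A B _ [f fE] _ [g gE]|A B _ [f fE] _ [g gE]].
- have [t tE] := term_of_poly p.
  by exists (Equal t (GRing.NatConst _ 0)) => x /=; rewrite tE.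
- have [t tE] := term_of_poly p.
  by exists (Lt (GRing.NatConst _ 0) t) => x /=; rewrite tE.
- by exists (Not f) => x /=; rewrite fE.
- by exists (And f g) => x /=; rewrite fE gE.
- by exists (Or f g) => x /=; rewrite fE gE.
Qed.

Let semialgebraic_qf n (f : formula R) : qf_form f -> rformula f ->
  semialgebraic [set x : 'rV[R]_n | holds (env x) f].
Proof.
have sub t u : GRing.rterm t -> GRing.rterm u ->
    exists p : mpoly n R, forall x,
      GRing.eval (env x) t - GRing.eval (env x) u = peval p x.
  move=> /(@poly_of_term n)[p pE] /(@poly_of_term n)[q qE]; exists (p - q) => x.
  by rewrite pE qE /peval mevalB.
elim: f => //=.
- case=> _ _; rewrite ?set_true ?set_false.
    exact: semialgebraicT.
  exact: semialgebraic0.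
- move=> t u _ /andP[/sub + ru]=> /(_ _ ru)[p pE].
  rewrite (_ : mkset _ = [set x | peval p x = 0]); first exact: semialgebraic_eq0.
  apply/seteqP; split=> x /=; rewrite -pE; first by move=> ->; rewrite subrr.
  by move=> /eqP; rewrite subr_eq0 => /eqP.
- move=> t u _ /andP[rt /sub]=> /(_ _ rt)[p pE].
  rewrite (_ : mkset _ = [set x | 0 < peval p x]); first exact: semialgebraic_gt0.
  by apply/seteqP; split=> x /=; rewrite -pE subr_gt0.
- move=> t u _ /andP[/sub + ru]=> /(_ _ ru)[p pE].
  rewrite (_ : mkset _ = ~` [set x | 0 < peval p x]).
    exact/semialgebraicC/semialgebraic_gt0.
  by apply/seteqP; split=> x /=; rewrite -pE subr_gt0 leNgt => /negP.
- move=> f IHf g IHg /andP[? ?] /andP[? ?].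
  by apply: semialgebraicI; [apply: IHf|apply: IHg].
- move=> f IHf g IHg /andP[? ?] /andP[? ?].
  by apply: semialgebraicU; [apply: IHf|apply: IHg].
- move=> f IHf g IHg /andP[? ?] /andP[? ?].
  rewrite (_ : mkset _ = ~` [set x | holds (env x) f] `|`
    [set x | holds (env x) g]); last first.
    apply/seteqP; split=> x /=; last by case.
    by move=> fg; case: (pselect (holds (env x) f)); [right; apply: fg|left].
  by apply: semialgebraicU; [apply/semialgebraicC/IHf|apply: IHg].
- by move=> f IHf ? ?; apply/semialgebraicC/IHf.
Qed.

Let semialgebraic_formula n (f : formula R) :
  semialgebraic [set x : 'rV[R]_n | holds (env x) f].
Proof.
pose g := quantifier_elim
    (fun i bc => qe_rcf.qfr_to_formula (qe_rcf.wproj i bc)) (to_rform f).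
have /andP[qg rg] : qf_form g && rformula g.
  by apply: quantifier_elim_wf; [exact: qe_rcf.wf_QE_wproj|exact: to_rform_rformula].
rewrite (_ : mkset _ = [set x : 'rV[R]_n | holds (env x) g]).
  exact: semialgebraic_qf.
apply/seteqP; split=> x /=.
  move=> /to_rformP fx; apply/(qf_evalP _ qg).
  by apply/(quantifier_elim_rformP (@qe_rcf.wf_QE_wproj R)
    (@qe_rcf.valid_QE_wproj R) _ (to_rform_rformula f)).
move=> /(qf_evalP _ qg) gx; apply/to_rformP.
by apply/(quantifier_elim_rformP (@qe_rcf.wf_QE_wproj R)
    (@qe_rcf.valid_QE_wproj R) _ (to_rform_rformula f)).
Qed.

Lemma semialgebraic_proj n (A : set 'rV[R]_(n + 1)) : semialgebraic A ->
  semialgebraic [set x : 'rV[R]_n | exists y : R, A (row_mx x (const_mx y))].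
Proof.
move=> /formula_of_semialgebraic[f fE].
rewrite (_ : mkset _ = [set x : 'rV[R]_n | holds (env x) (Exists n f)]).
  exact: semialgebraic_formula.
have env1 (x : 'rV[R]_n) y :
    GRing.same_env (env (row_mx x (const_mx y : 'rV_1))) (set_nth 0 (env x) n y).
  move=> i; rewrite nth_set_nth /=; have [ni|ni|->] := ltngtP i n.
  - rewrite (nth_env _ (lshift 1 (Ordinal ni))) row_mxEl.
    by rewrite -(nth_env _ (Ordinal ni)).
  - by rewrite !nth_env0 ?addn1// ltnW.
  - have := nth_env (row_mx x (const_mx y : 'rV_1)) (rshift n ord0).
    by rewrite row_mxEr mxE /= addn0.
apply/seteqP; split=> x /= [y Ay]; exists y.
  by apply: eq_holds (env1 x y) _; apply/fE.
by apply/fE; apply: eq_holds Ay; exact/GRing.same_env_sym/env1.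
Qed.

End Semialgebraic.

Section BoundedSemialgebraic.
Variables (R : realType) (m : nat).
Implicit Type M : set 'rV[R]_m.

(* R^m x R is identified with R^(m + 1). *)
Definition graph M (f : M -> R) : set 'rV[R]_(m + 1) :=
  range (fun x : M => row_mx (set_val x) (const_mx (f x))).

(* The domain is the subtype of M, with the subspace topology; the topology of
   'rV[R]_m is the Euclidean one. hM is needed for the constant functions. *)
Definition bounded_semialgebraic M (hM : semialgebraic M) : {pred M -> R} :=
  mem [set f : M -> R |
    [/\ continuous f, bounded_fun f & semialgebraic (graph f)]].

Let evalX n (x : 'rV[R]_n) i : peval (mpolyX _ (mnm1 i)) x = x ord0 i.
Proof. by rewrite /peval mevalXU. Qed.

Lemma semialgebraic_graph_cst M (hM : semialgebraic M) (c : R) :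
  semialgebraic (graph (fun _ : M => c)).
Proof.
pose q (i : 'I_m) : mpoly (m + 1) R := mpolyX _ (mnm1 (lshift 1 i)).
pose p : mpoly (m + 1) R := mpolyX _ (mnm1 (rshift m ord0)) - mpolyC _ c.
have pE v : peval p v = v ord0 (rshift m ord0) - c.
  by rewrite /p /peval mevalB mevalC mevalXU.
have qE v : \row_(i < m) peval (q i) v = lsubmx v.
  by apply/rowP => i; rewrite !mxE evalX.
rewrite (_ : graph _ = [set v | M (\row_(i < m) peval (q i) v)] `&`
                       [set v | peval p v = 0]).
  by apply: semialgebraicI; [exact: semialgebraic_preimage|exact: semialgebraic_eq0].
apply/seteqP; split=> v /=.
  move=> [x _ <-]; rewrite qE pE row_mxKl row_mxEr mxE subrr; split=> //.
  exact: set_valP.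
rewrite qE pE => -[Mv /eqP]; rewrite subr_eq0 => /eqP vc.
exists (SigSub (mem_set Mv)) => //=; rewrite -[RHS]hsubmxK; congr row_mx.
by apply/rowP => i; rewrite ord1 !mxE vc.
Qed.

Let graph_op M (f g : M -> R) (op : R -> R -> R) (p : mpoly (m + 1 + 1 + 1) R) :
  (forall (x : 'rV[R]_m) t y z, t = op y z <->
     peval p (row_mx (row_mx (row_mx x (const_mx t)) (const_mx y)) (const_mx z)) = 0) ->
  semialgebraic (graph f) -> semialgebraic (graph g) ->
  semialgebraic (graph (fun x => op (f x) (g x))).
Proof.
move=> pE sf sg.
pose q (j : 'I_(m + 1 + 1 + 1)) (i : 'I_(m + 1)) : mpoly (m + 1 + 1 + 1) R :=
  mpolyX _ (mnm1 (if fintype.split i is inl k then lshift 1 (lshift 1 (lshift 1 k)) else j)).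
have qE j (x : 'rV[R]_m) t y z :
    let v := row_mx (row_mx (row_mx x (const_mx t : 'rV_1)) (const_mx y : 'rV_1))
                    (const_mx z : 'rV_1) in
    \row_(i < m + 1) peval (q j i) v = row_mx x (const_mx (v ord0 j)).
  move=> v; apply/rowP => i; rewrite mxE evalX.
  rewrite -{2}(splitK i); case: (fintype.split i) => k /=.
    by rewrite !row_mxEl.
  by rewrite row_mxEr [RHS]mxE.
have := semialgebraicI (semialgebraicI
  (semialgebraic_preimage (q (lshift 1 (rshift (m + 1) ord0))) sf)
  (semialgebraic_preimage (q (rshift (m + 1 + 1) ord0)) sg)) (semialgebraic_eq0 p).
move=> /semialgebraic_proj/semialgebraic_proj.
congr semialgebraic; apply/seteqP; split=> v /=.
  have -> : v = row_mx (lsubmx v) (const_mx (rsubmx v ord0 ord0)).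
    by rewrite -[LHS]hsubmxK; congr row_mx; apply/rowP => i; rewrite ord1 [RHS]mxE.
  move: (lsubmx v) (rsubmx v ord0 ord0) => u s [y [z [[]]]].
  rewrite !qE row_mxEl !row_mxEr !mxE => -[x _ /eq_row_mx[xv fy]].
  move=> [x' _ /eq_row_mx[x'v gz]] /pE ->.
  have ? : x' = x by apply: val_inj; rewrite -set_valE x'v -xv.
  subst x'; exists x => //; rewrite xv; congr row_mx; apply/rowP => i.
  by move/rowP/(_ i): fy; move/rowP/(_ i): gz; rewrite !mxE => <- <-.
move=> [x _ <-]; exists (f x), (g x); rewrite !qE row_mxEl !row_mxEr !mxE; split.
  by split; exists x.
exact/pE.
Qed.

Fact bounded_semialgebraic_subring M (hM : semialgebraic M) :
  subring_closed (bounded_semialgebraic hM).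
Proof.
pose X i : mpoly (m + 1 + 1 + 1) R := mpolyX _ (mnm1 i).
pose t := X (lshift 1 (lshift 1 (rshift m ord0))).
pose y := X (lshift 1 (rshift (m + 1) ord0)).
pose z := X (rshift (m + 1 + 1) ord0).
split.
- apply/mem_set; split.
  + exact: cst_continuous.
  + exact: bounded_cst.
  + exact: semialgebraic_graph_cst.
- move=> f g /set_mem[cf bf sf] /set_mem[cg bg sg]; apply/mem_set; split.
  + by move=> x; exact: (cvgB (cf x) (cg x)).
  + exact: bounded_funD bf (bounded_funN bg).
  + apply: (@graph_op _ f g (fun a b => a - b) (t - (y - z))) => // x a b c.
    rewrite /peval !mevalB !mevalXU !(row_mxEl, row_mxEr) !mxE.
    by split=> [->|/eqP]; rewrite ?subrr// subr_eq0 => /eqP.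
- move=> f g /set_mem[cf bf sf] /set_mem[cg bg sg]; apply/mem_set; split.
  + by move=> x; exact: (cvgM (cf x) (cg x)).
  + have [a a0 fa] := pinfty_ex_gt0 bf; have [b b0 gb] := pinfty_ex_gt0 bg.
    rewrite /bounded_near /=; near=> C => x _ /=; rewrite normrM.
    by apply: (@le_trans _ _ (a * b)) => //; rewrite ler_pM// ?fa ?gb.
  + apply: (@graph_op _ f g (fun a b => a * b) (t - y * z)) => // x a b c.
    rewrite /peval !mevalB mevalM !mevalXU !(row_mxEl, row_mxEr) !mxE.
    by split=> [->|/eqP]; rewrite ?subrr// subr_eq0 => /eqP.
Unshelve. all: by end_near. Qed.

HB.instance Definition _ M (hM : semialgebraic M) :=
  GRing.isSubringClosed.Build (M -> R) (bounded_semialgebraic hM)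
    (bounded_semialgebraic_subring hM).

(* The ring S^*(M), a subring of the ring of functions M -> R. *)
Record Sstar M (hM : semialgebraic M) := MkSstar {
  Sstar_fun :> M -> R;
  Sstar_funP : Sstar_fun \in bounded_semialgebraic hM }.

HB.instance Definition _ M (hM : semialgebraic M) :=
  [isSub for @Sstar_fun M hM].
HB.instance Definition _ M (hM : semialgebraic M) :=
  [Choice of Sstar hM by <:].
HB.instance Definition _ M (hM : semialgebraic M) :=
  GRing.SubChoice_isSubComPzRing.Build (M -> R) (bounded_semialgebraic hM)
    (Sstar hM) (bounded_semialgebraic_subring hM).

Section SstarE.
Variables (M : set 'rV[R]_m) (hM : semialgebraic M).
Implicit Types (f g : Sstar hM) (x : M).

Lemma Sstar0E x : (0 : Sstar hM) x = 0.
Proof. by rewrite -[LHS]/(\val (0 : Sstar hM) x) raddf0. Qed.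

Lemma Sstar1E x : (1 : Sstar hM) x = 1.
Proof. by rewrite -[LHS]/(\val (1 : Sstar hM) x) rmorph1. Qed.

Lemma SstarDE f g x : (f + g) x = f x + g x.
Proof. by rewrite -[LHS]/(\val (f + g) x) raddfD. Qed.

Lemma SstarBE f g x : (f - g) x = f x - g x.
Proof. by rewrite -[LHS]/(\val (f - g) x) raddfB. Qed.

Lemma SstarME f g x : (f * g) x = f x * g x.
Proof. by rewrite -[LHS]/(\val (f * g) x) rmorphM. Qed.

End SstarE.

End BoundedSemialgebraic.

Section MaximalSpectrum.
Variable A : comPzRingType.

Definition ideal (I : set A) : Prop :=
  [/\ I 0, (forall f g, I f -> I g -> I (f + g)) &
      (forall f g, I g -> I (f * g))].

Definition maximal_ideal (I : set A) : Prop :=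
  [/\ ideal I, I <> setT &
      forall J, ideal J -> I `<=` J -> J = I \/ J = setT].

(* The maximal ideals, with the topology induced by the Zariski topology, whose
   basis consists of the sets basic_open f. *)
Record maxspec := MaxSpec {
  max_ideal : set A;
  max_idealP : maximal_ideal max_ideal }.

HB.instance Definition _ := gen_eqMixin maxspec.
HB.instance Definition _ := gen_choiceMixin maxspec.

Definition basic_open (f : A) : set maxspec := [set I : maxspec | ~ max_ideal I f].

Lemma maxspec_prime (I : maxspec) f g :
  max_ideal I (f * g) -> max_ideal I f \/ max_ideal I g.
Proof.
case: I => I [[I0 ID IM] IT Imax] /= Ifg.
have [|If] := pselect (I f); [by left|right].
pose J := [set h | exists a b, I a /\ h = a + b * f].
have [|| JI|JT] := Imax J.
- split.
  + by exists 0, 0; rewrite mul0r addr0.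
  + move=> _ _ [a [b [Ia ->]]] [c [d [Ic ->]]]; exists (a + c), (b + d).
    by split; [exact: ID|rewrite mulrDl addrACA].
  + move=> h _ [a [b [Ia ->]]]; exists (h * a), (h * b).
    by split; [exact: IM|rewrite mulrDr mulrA].
- by move=> a Ia; exists a, 0; rewrite mul0r addr0.
- by case: If; rewrite -JI; exists 0, 1; rewrite mul1r add0r.
- have [a [b [Ia e]]] : J 1 by rewrite JT.
  rewrite -(mul1r g) e mulrDl -mulrA; apply: ID; last exact: IM.
  by rewrite mulrC; exact: IM.
Qed.

Lemma maxspec1 (I : maxspec) : ~ max_ideal I 1.
Proof.
case: I => I [[I0 ID IM] IT _] /= I1; apply: IT.
by apply/seteqP; split=> // f _; rewrite -(mulr1 f); exact: IM.
Qed.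

Fact basic_open_cover : \bigcup_(U in range basic_open) U = setT.
Proof.
apply/seteqP; split=> // I _; exists (basic_open 1); last exact: maxspec1.
by exists 1.
Qed.

Fact basic_open_join U V (I : maxspec) :
  range basic_open U -> range basic_open V -> U I -> V I ->
  exists W, [/\ range basic_open W, W I & W `<=` U `&` V].
Proof.
move=> [f _ <-] [g _ <-] If Ig; exists (basic_open (f * g)).
split; [by exists (f * g)|by move=> /maxspec_prime[]|].
move=> J /= Jfg; have [[_ _ JM] _ _] := max_idealP J.
by split=> ?; apply: Jfg; [rewrite mulrC|]; exact: JM.
Qed.

HB.instance Definition _ :=
  isBaseTopological.Build maxspec basic_open_cover basic_open_join.

End MaximalSpectrum.

Section BetaS.
Variables (R : realType) (m : nat) (M : set 'rV[R]_m) (hM : semialgebraic M).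

Definition beta_s : topologicalType := maxspec (Sstar hM).

Fact vanishing_ideal_maximal (p : M) :
  maximal_ideal [set f : Sstar hM | f p = 0].
Proof.
split.
- split=> [|f g fp gp|f g gp]; first exact: Sstar0E.
  + by rewrite /mkset SstarDE fp gp addr0.
  + by rewrite /mkset SstarME gp mulr0.
- move=> /seteqP[_ /(_ 1 I)]; rewrite /mkset Sstar1E => /eqP.
  by rewrite oner_eq0.
move=> J [J0 JD JM] pJ; have [Jp|] := pselect (J `<=` [set f | f p = 0]).
  by left; apply/seteqP.
move=> /existsNP[f /not_implyP[Jf /= fp]]; right.
have [c cE] : exists c : Sstar hM, forall x, c x = (f p)^-1.
  have cP : (fun _ : M => (f p)^-1) \in bounded_semialgebraic hM.
    apply/mem_set; split.
    + exact: cst_continuous.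
    + exact: bounded_cst.
    + exact: semialgebraic_graph_cst.
  by exists (MkSstar cP).
have J1 : J 1.
  rewrite -(subrK (c * f) 1); apply: JD; last exact: JM.
  apply: pJ; rewrite /mkset SstarBE SstarME Sstar1E cE mulVf ?subrr//.
  exact/eqP.
by apply/seteqP; split=> // g _; rewrite -(mulr1 g); exact: JM.
Qed.

(* The embedding of M in beta_s^* M. *)
Definition beta_s_point (p : M) : beta_s := MaxSpec (vanishing_ideal_maximal p).

End BetaS.

(* The neighborhoods B k need not be open. *)
Definition nbhs_basis (T : topologicalType) (x : T) (B : nat -> set T) : Prop :=
  (forall k, nbhs x (B k)) /\
  (forall V, nbhs x V -> exists k, B k `<=` V).

(* Main.v *)
Require Import Defs.
From mathcomp Require Import all_boot all_order all_algebra.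
From mathcomp Require Import -(notations) mpoly.
From mathcomp Require Import all_classical all_reals all_analysis.
From mathcomp Require Import lra.

Import numFieldNormedType.Exports.
Import Order.TTheory GRing.Theory Num.Theory.

Local Open Scope classical_set_scope.
Local Open Scope ring_scope.

(** The basic open sets of f in S^*(M) generate the topology of beta_s^* M, so
everything reduces to two constructions of functions in S^*(M).

Closures of neighborhoods are neighborhoods. If f in S^*(M) vanishes on M
outside U, then basic_open f lies in the closure of U
([basic_open_sub_closure]): when a maximal ideal contains neither f nor g, it
does not contain f g, so f g is not the zero function, and any point x where
f g does not vanish lies in U and in basic_open g. A neighborhood U of p
contains the nonvanishing locus of a bump function f with f p != 0
([Sstar_bump]), namely the positive part of eps^2 - |x - p|^2.

Closures of small neighborhoods are small. Let f p != 0. If some u in S^*(M)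
satisfies u f = 1 on U, then 1 - u f vanishes on U, hence belongs to every
maximal ideal in the closure of U; such an ideal cannot contain f
([closure_sub_basic_open]). With 0 < c < |f p| one takes U inside the
neighborhood |f| > c of p and u = f / max(f^2, c^2), which is bounded and equals
1 / f on that neighborhood ([Sstar_local_inverse]).

Both functions have the form phi o g with phi a continuous semialgebraic
function of one real variable; the graph of such a composition is semialgebraic
by Tarski-Seidenberg ([semialgebraic_graph_comp]). *)

(** * Semialgebraic graphs *)

(** The shape of the graph of a function given by one rational expression where
r is positive and by another elsewhere, after clearing denominators. *)
Lemma semialgebraic_if {R : rcfType} {n} (r a b : mpoly n R) :
  semialgebraic [set v : 'rV[R]_n |
    if 0 < peval r v then peval a v = 0 else peval b v = 0].
Proof.
rewrite (_ : mkset _ =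
    ([set v | 0 < peval r v] `&` [set v | peval a v = 0]) `|`
    (~` [set v | 0 < peval r v] `&` [set v | peval b v = 0])).
  apply: semialgebraicU; apply: semialgebraicI.
  - exact: semialgebraic_gt0.
  - exact: semialgebraic_eq0.
  - exact/semialgebraicC/semialgebraic_gt0.
  - exact: semialgebraic_eq0.
by apply/seteqP; split=> v /=; case: ifP => rv;
  [left|right|case=> -[]|case=> -[]].
Qed.

Section Graphs.
Context {R : realType} {m : nat} {M : set 'rV[R]_m}.

Lemma semialgebraic_graph_peval (hM : semialgebraic M) (q : mpoly m R) :
  semialgebraic (graph (fun x : M => peval q (set_val x))).
Proof.
pose X (i : 'I_m) : mpoly (m + 1) R := mpolyX _ (mnm1 (lshift 1 i)).
pose y : mpoly (m + 1) R := mpolyX _ (mnm1 (rshift m ord0)).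
have XE v : \row_(i < m) peval (X i) v = lsubmx v.
  by apply/rowP => i; rewrite !mxE /peval mevalXU.
pose r := y - comp_mpoly [tuple X i | i < m] q.
have rE v : peval r v = v ord0 (rshift m ord0) - peval q (lsubmx v).
  rewrite /peval mevalB mevalXU comp_mpoly_meval; congr (_ - _).
  apply: meval_eq => i; rewrite tnth_mktuple.
  by move/rowP/(_ i): (XE v); rewrite mxE.
rewrite (_ : graph _ = [set v | M (\row_(i < m) peval (X i) v)] `&`
                       [set v | peval r v = 0]).
  by apply: semialgebraicI; [exact: semialgebraic_preimage|exact: semialgebraic_eq0].
apply/seteqP; split=> v /=.
  move=> [x _ <-]; rewrite XE rE row_mxKl row_mxEr mxE subrr; split=> //.
  exact: set_valP.
rewrite XE rE => -[Mv /eqP]; rewrite subr_eq0 => /eqP vq.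
exists (SigSub (mem_set Mv)) => //=; rewrite -[RHS]hsubmxK; congr row_mx.
by apply/rowP => i; rewrite ord1 !mxE vq.
Qed.

(** A point (x, y) is on the graph of phi o f when, for some z, (x, z) is on the
graph of f and (z, y) on the graph of phi: the set of such (x, y, z) is
semialgebraic, and so is its projection. *)
Lemma semialgebraic_graph_comp (f : M -> R) (phi : R -> R) :
  semialgebraic (graph f) ->
  semialgebraic [set v : 'rV[R]_2 | v ord0 ord_max = phi (v ord0 ord0)] ->
  semialgebraic (graph (phi \o f)).
Proof.
move=> sf sphi.
pose X i : mpoly (m + 1 + 1) R := mpolyX _ (mnm1 i).
(* The coordinates of 'rV_(m + 1 + 1) are those of x, then y, then z. *)
pose yi : 'I_(m + 1 + 1) := lshift 1 (rshift m ord0).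
pose zi : 'I_(m + 1 + 1) := rshift (m + 1) ord0.
pose q (i : 'I_(m + 1)) :=
  if fintype.split i is inl k then X (lshift 1 (lshift 1 k)) else X zi.
pose w (i : 'I_2) := if i == ord0 then X zi else X yi.
have qE (v : 'rV[R]_(m + 1)) z : \row_(i < m + 1) peval (q i) (row_mx v (const_mx z)) =
    row_mx (lsubmx v) (const_mx z).
  apply/rowP => i; rewrite mxE /q.
  rewrite -{2}(splitK i); case: (fintype.split i) => k /=.
    by rewrite /peval mevalXU !row_mxEl mxE.
  by rewrite /peval mevalXU !row_mxEr !mxE.
have := semialgebraicI (semialgebraic_preimage q sf) (semialgebraic_preimage w sphi).
move=> /semialgebraic_proj; congr semialgebraic.
have wE (v : 'rV[R]_(m + 1)) z :
    let a := \row_(i < 2) peval (w i) (row_mx v (const_mx z)) in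
    (a ord0 ord_max = phi (a ord0 ord0)) = (v ord0 (rshift m ord0) = phi z).
  by rewrite /= !mxE /w /= /peval !mevalXU row_mxEl row_mxEr mxE.
apply/seteqP; split=> v /=.
  move=> [z []]; rewrite qE wE => -[x _ /eq_row_mx[xv /rowP/(_ ord0)]].
  rewrite !mxE => fz vz; exists x => //.
  rewrite -[RHS]hsubmxK xv; congr row_mx.
  by apply/rowP => i; rewrite ord1 !mxE vz /= fz.
move=> [x _ <-]; exists (f x); rewrite qE wE row_mxKl row_mxEr mxE; split=> //.
by exists x.
Qed.

Lemma peval_continuous (q : mpoly m R) : continuous (peval q).
Proof.
rewrite (_ : peval q = fun x : 'rV[R]_m =>
    \sum_(e <- msupp q) mcoeff e q * \prod_i x ord0 i ^+ e i); last first.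
  by apply/funext => x; rewrite /peval mevalE.
apply: (@continuous_big _ _ +%R) => [|e _]; first exact: add_continuous.
have cX : continuous (fun x : 'rV[R]_m => \prod_i x ord0 i ^+ e i).
  apply: (@continuous_big R _ *%R 1 xpredT (@mul_continuous R)) => i _ x.
  have cx := @coord_continuous R 1 m ord0 i x.
  exact: (continuous_comp cx (@exprn_continuous R (e i) _)).
by move=> x; exact: (continuous_comp (cX x) (@mulrl_continuous R (mcoeff e q) _)).
Qed.

End Graphs.

(** * Bump functions and local inverses in S^*(M) *)

Section Functions.
Context {R : realType} {m : nat} {M : set 'rV[R]_m} (hM : semialgebraic M).

Lemma Sstar_comp (f : M -> R) (phi : R -> R) :
  continuous f -> semialgebraic (graph f) ->
  continuous phi ->
  semialgebraic [set v : 'rV[R]_2 | v ord0 ord_max = phi (v ord0 ord0)] ->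
  bounded_fun (phi \o f) ->
  exists g : Sstar hM, forall x, g x = phi (f x).
Proof.
move=> cf sf cphi sphi b.
have gP : phi \o f \in bounded_semialgebraic hM.
  apply/mem_set; split=> //; last exact: semialgebraic_graph_comp.
  by move=> x; apply: continuous_comp; [exact: cf|exact: cphi].
by exists (MkSstar gP).
Qed.

(** Clipping at 0 keeps the values of eps^2 - |x - p|^2 in [0, eps^2], so the
result is bounded even if M is not. *)
Lemma Sstar_bump {p : M} {V : set M} : nbhs p V ->
  exists f : Sstar hM, f p != 0 /\ forall x, f x != 0 -> V x.
Proof.
move=> [_ [[A oA <-] /= Ap AV]].
have [e /= e0 eA] : exists2 e : R, 0 < e & ball (set_val p) e `<=` A.
  by apply/nbhs_ballP; exact: open_nbhs_nbhs.
pose q : mpoly m R := mpolyC _ (e ^+ 2) -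
  \sum_(i < m) (mpolyX _ (mnm1 i) - mpolyC _ (set_val p ord0 i)) ^+ 2.
have qE x : peval q x = e ^+ 2 - \sum_(i < m) (x ord0 i - set_val p ord0 i) ^+ 2.
  rewrite /peval mevalB mevalC; congr (_ - _); rewrite raddf_sum.
  by apply: eq_bigr => i _; rewrite /= rmorphXn/= mevalB mevalXU mevalC.
have [f fE] : exists f : Sstar hM, forall x : M,
    f x = Num.max 0 (peval q (set_val x)).
  apply: (@Sstar_comp (fun x => peval q (set_val x)) (Num.max 0)).
  - move=> x; apply: continuous_comp; last exact: peval_continuous.
    exact: initial_continuous.
  - exact: semialgebraic_graph_peval.
  - by apply: max_fun_continuous => x; [exact: cvg_cst|exact: cvg_id].
  - pose y : mpoly 2 R := mpolyX _ (mnm1 ord_max).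
    pose z : mpoly 2 R := mpolyX _ (mnm1 ord0).
    have := semialgebraic_if z (y - z) y; congr semialgebraic.
    apply/seteqP; split=> v /=; rewrite /peval mevalB !mevalXU; case: ltP => _ //.
      by move=> /eqP; rewrite subr_eq0 => /eqP.
    by move=> ->; rewrite subrr.
  - rewrite /bounded_near; near=> C => x _ /=.
    apply: (@le_trans _ _ (e ^+ 2)) => //.
    rewrite ger0_norm ?le_max ?lexx// ge_max sqr_ge0 qE lerBlDr lerDl.
    by apply: sumr_ge0 => i _; exact: sqr_ge0.
exists f; split.
  rewrite fE qE big1 => [|i _]; last by rewrite subrr expr0n.
  by rewrite subr0 gt_eqF// lt_max exprn_gt0 ?orbT.
move=> x; rewrite fE => fx; apply: AV; apply: eA; split=> // i j.
(* The balls of 'rV_m are those of the sup norm: each coordinate is controlled by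
   the sum of squares. *)
rewrite ord1 -ball_normE /= distrC.
have : 0 < peval q (set_val x).
  by move: fx; case: (ltP 0 (peval q _)) => //; rewrite eqxx.
rewrite qE subr_gt0 => se.
rewrite -(ltr_pXn2r (n := 2)) ?nnegrE ?(ltW e0)// real_normK ?num_real//.
apply: le_lt_trans se; rewrite (bigD1 j) //= lerDl.
by apply: sumr_ge0 => k _; exact: sqr_ge0.
Unshelve. all: by end_near. Qed.

(** The function 1 / f need not be bounded, or even defined, on all of M;
f / max(f^2, c^2) is bounded by 1 / c and coincides with 1 / f where
|f| > c. *)
Lemma Sstar_local_inverse (f : Sstar hM) {c : R} : 0 < c ->
  exists u : Sstar hM, forall x : M, c < `|f x| -> u x * f x = 1.
Proof.
move=> c0.
have /set_mem[cf _ sf] := Sstar_funP f.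
pose d z := Num.max (z ^+ 2) (c ^+ 2).
have d0 z : 0 < d z by rewrite lt_max (exprn_gt0 2 c0) orbT.
have cd : continuous d.
  apply: max_fun_continuous => z; last exact: cvg_cst.
  exact: exprn_continuous.
have [u uE] : exists u : Sstar hM, forall x : M, u x = f x / d (f x).
  apply: (@Sstar_comp f (fun z => z / d z)) => //.
  - move=> z; apply: cvgM; first exact: cvg_id.
    by apply: cvgV; [rewrite gt_eqF|exact: cd].
  - pose y : mpoly 2 R := mpolyX _ (mnm1 ord_max).
    pose z : mpoly 2 R := mpolyX _ (mnm1 ord0).
    have := semialgebraic_if (z ^+ 2 - mpolyC _ (c ^+ 2))
      (y * z ^+ 2 - z) (y * mpolyC _ (c ^+ 2) - z).
    congr semialgebraic; rewrite /peval.
    have dE (a b : R) : a = b / d b <-> a * d b - b = 0.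
      split=> [->|/eqP]; first by rewrite divfK ?subrr// gt_eqF.
      rewrite subr_eq0 => /eqP e; apply: (mulIf (lt0r_neq0 (d0 b))).
      by rewrite e divfK ?lt0r_neq0.
    apply/seteqP; split=> v /=; rewrite !mevalB !mevalM !rmorphXn/= !mevalXU mevalC;
      rewrite subr_gt0 dE /d; case: ltP => //.
  - rewrite /bounded_near; near=> C => x _ /=.
    apply: (@le_trans _ _ c^-1) => //.
    rewrite normrM normfV (gtr0_norm (d0 _)) ler_pdivrMr//.
    rewrite mulrC ler_pdivlMr// /d -[(f x) ^+ 2]real_normK ?num_real//.
    have := normr_ge0 (f x); move: `|f x| => t t0.
    by rewrite le_max; case: (leP c t) => ct; apply/orP; [left|right]; nra.
exists u => x fx; rewrite uE mulrAC -expr2.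
rewrite (_ : d (f x) = f x ^+ 2).
  by rewrite mulfV// expf_neq0// -normr_gt0 (lt_trans c0).
by apply/max_idPl; rewrite -[leRHS]real_normK ?num_real// lerXn2r ?nnegrE// ltW.
Unshelve. all: by end_near. Qed.

End Functions.

(** * Closures in the maximal spectrum *)

Lemma basic_open_open {A : comPzRingType} (f : A) : open (basic_open f).
Proof.
exists [set basic_open f]; first by move=> _ ->; exists f.
by rewrite bigcup_set1.
Qed.

Lemma nbhs_basic_open {A : comPzRingType} {I : maxspec A} {V : set (maxspec A)} :
  nbhs I V ->
  exists f, basic_open f I /\ basic_open f `<=` V.
Proof.
rewrite nbhsE => -[_ [[D DB <-] [B DB' BI]] BV].
have [f _ fB] := DB _ DB'; exists f; rewrite fB; split=> // J BJ.
by apply: BV; exists B.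
Qed.

Section Closures.
Context {R : realType} {m : nat} {M : set 'rV[R]_m} (hM : semialgebraic M).
Implicit Types (f : Sstar hM) (U : set M).

(** Maximal ideals are prime, so basic_open f and basic_open g can only meet if
f g is not the zero function, that is, if they meet in a point of M. *)
Lemma basic_open_sub_closure {f U} : (forall x, f x != 0 -> U x) ->
  basic_open f `<=` closure (beta_s_point hM @` U).
Proof.
move=> fU I If B /nbhs_basic_open[g [Ig gB]].
have [x fgx] : exists x, f x * g x != 0.
  apply: contrapT => /forallNP fg0.
  have /maxspec_prime[//|//] : max_ideal I (f * g).
  have -> : f * g = 0.
    apply: val_inj; apply/funext => x.
    rewrite -[LHS]/((f * g) x) -[RHS]/((0 : Sstar hM) x) SstarME Sstar0E.
    by have /negP := fg0 x; rewrite negbK => /eqP.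
  by have [[]] := max_idealP I.
move: fgx; rewrite mulf_eq0 negb_or => /andP[fx gx].
exists (beta_s_point hM x); split; first by exists x => //; exact: fU.
by apply: gB => /=; exact/eqP.
Qed.

(** The zero set of h in beta_s^* M is closed. *)
Lemma closure_vanishing {U} {h : Sstar hM} {I : beta_s hM} :
  (forall x, U x -> h x = 0) -> closure (beta_s_point hM @` U) I -> max_ideal I h.
Proof.
move=> hU UI; apply: contrapT => Ih.
have [_ [[x Ux <-]]] := UI _ (open_nbhs_nbhs (conj (basic_open_open h) Ih)).
by apply; exact: hU.
Qed.

(** An ideal containing both f and 1 - u f is the whole ring. *)
Lemma closure_sub_basic_open {U f} (u : Sstar hM) :
  (forall x, U x -> u x * f x = 1) ->
  closure (beta_s_point hM @` U) `<=` basic_open f.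
Proof.
move=> ufU I UI If.
have Iuf : max_ideal I (1 - u * f).
  apply: closure_vanishing UI => x Ux.
  by rewrite SstarBE SstarME Sstar1E ufU// subrr.
have [[_ ID IM] _ _] := max_idealP I.
by apply: (@maxspec1 _ I); rewrite -(subrK (u * f) 1); apply: ID => //; exact: IM.
Qed.

End Closures.

Theorem proposition3p9 (R : realType) (m : nat) (M : set 'rV[R]_m)
    (hM : semialgebraic M) (p : M) (U : nat -> set M)
    (hU : nbhs_basis p U) :
  nbhs_basis (beta_s_point hM p) (fun k => closure (beta_s_point hM @` (U k))).
Proof.
have [Unbhs Ubasis] := hU; split=> [k|V /nbhs_basic_open[f [/eqP /= fp fV]]].
  have [f [fp fU]] := Sstar_bump hM (Unbhs k).
  apply: filterS (basic_open_sub_closure hM fU) _.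
  apply: open_nbhs_nbhs; split; first exact: basic_open_open.
  exact/eqP.
have [c c0 cfp] : exists2 c, 0 < c & c < `|f p|.
  exists (`|f p| / 2); first by rewrite divr_gt0 ?normr_gt0.
  by rewrite gtr_pMr ?normr_gt0// invf_lt1 ?ltr1n.
have [u uf] := Sstar_local_inverse hM f c0.
have /set_mem[cf _ _] := Sstar_funP f.
have [k Uk] : exists k, U k `<=` [set x | c < `|f x|].
  apply: Ubasis; exact: (cvgr_gt _ (cvg_norm (cf p)) _ cfp).
exists k; apply: subset_trans fV; apply: (closure_sub_basic_open hM u).
by move=> x /Uk; exact: uf.
Qed.
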